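(* Let $X$ be a real Banach space and let $M \subseteq X$ be an $M$-ideal in $X$. If $X^*$ has the $w^*$-Strong diameter two property, then $M^*$ has the $w^*$-Strong diameter two property.
   Context: All Banach spaces are real and nonzero (in particular $M \neq \{0\}$). For a Banach space $Z$, $Z^*$ is its dual and $B_Z$ its closed unit ball. Diameters are taken with respect to the norm. $M$-ideals. A linear projection $P$ on a Banach space $Z$ is an $L$-projection if $\|z\| = \|Pz\| + \|z - Pz\|$ for all $z \in Z$. For a subspace $M \subseteq X$, its annihilator is $M^\perp = \{x^* \in X^* : x^*(m) = 0 \ \forall m \in M\}$. A closed subspace $M \subseteq X$ is an $M$-ideal in $X$ if there is an $L$-projection $P : X^* \to X^*$ with $\ker P = M^\perp$. $w^*$-slices. For a Banach space $Z$, a $w^*$-slice of $B_{Z^*}$ is a set of the form $\{z^* \in B_{Z^*} : z^*(z) > \sup_{u^* \in B_{Z^*}} u^*(z) - \alpha\}$ with $z \in Z$ and $\alpha > 0$. A convex combination of $w^*$-slices of $B_{Z^*}$ is a set $\sum_{i=1}^n \lambda_i S_i = \{\sum_{i=1}^n \lambda_i s_i : s_i \in S_i\}$, where $n \geq 1$, each $S_i$ is a $w^*$-slice of $B_{Z^*}$, $\lambda_i \in [0,1]$ and $\sum_{i=1}^n \lambda_i = 1$. The dual space $Z^*$ has the $w^*$-Strong diameter two property if every convex combination of $w^*$-slices of $B_{Z^*}$ has diameter $2$. *)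

(* Defs.v *)
From HB Require Import structures.
From mathcomp Require Import all_boot all_order all_algebra.
From mathcomp Require Import all_classical all_reals all_analysis.

Set Implicit Arguments.
Unset Strict Implicit.
Unset Printing Implicit Defensive.

Import Order.TTheory GRing.Theory Num.Theory.
Import numFieldNormedType.Exports.

Local Open Scope classical_set_scope.
Local Open Scope ring_scope.

Section dual.
Context {R : realType} (Z : normedModType R).

Definition dual_pred : {pred Z -> R^o} :=
  fun f => `[< linear f /\ continuous f >].

Lemma dual_submod_closed : submod_closed dual_pred.
Proof.
split.
  apply/asboolP; split; last exact: cst_continuous.
  by move=> a x y; rewrite -[0]/(cst 0) /= scaler0 addr0.
move=> a f g /asboolP[fl fc] /asboolP[gl gc]; apply/asboolP; split.
  move=> b x y; rewrite -[LHS]/(a *: f (b *: x + y) + g (b *: x + y)) fl gl.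
  by rewrite !scalerDr !scalerA (mulrC a b) addrACA.
by move=> x; apply: cvgD; [apply: cvgZr; exact: fc|exact: gc].
Qed.

HB.instance Definition _ :=
  GRing.isSubmodClosed.Build R (Z -> R^o) dual_pred dual_submod_closed.

(** The library has no type of bounded functionals; [dual Z] is the submodule of
    continuous linear maps in [Z -> R^o], normed below by the operator norm. *)
Record dual := Dual {
  dual_fun :> Z -> R^o;
  dual_funP : dual_fun \in dual_pred }.

HB.instance Definition _ := [isSub for dual_fun].
HB.instance Definition _ := [Choice of dual by <:].
HB.instance Definition _ := [SubChoice_isSubLmodule of dual by <:].

Lemma dual_linear (f : dual) : linear f.
Proof. by have /asboolP[] := dual_funP f. Qed.

Lemma dual_continuous (f : dual) : continuous f.
Proof. by have /asboolP[] := dual_funP f. Qed.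

HB.instance Definition _ (f : dual) :=
  GRing.isLinear.Build R Z R^o *:%R f (dual_linear f).

Lemma dualD (f g : dual) z : (f + g) z = f z + g z. Proof. by []. Qed.
Lemma dualZ (a : R) (f : dual) z : (a *: f) z = a * f z. Proof. by []. Qed.

Definition opnorm (f : dual) : R := sup [set `|f z| | z in [set z | `|z| <= 1]].

Lemma opnorm_has_sup (f : dual) :
  has_sup [set `|f z| | z in [set z | `|z| <= 1]].
Proof.
split; first by exists `|f 0|; exists 0 => //=; rewrite normr0.
have /linear_bounded_continuous/bounded_funP/(_ 1)[C fC] := @dual_continuous f.
by exists C => _ [z z1 <-]; exact: fC.
Qed.

Lemma opnorm_ub (f : dual) z : `|z| <= 1 -> `|f z| <= opnorm f.
Proof.
by move=> z1; apply: (ub_le_sup (opnorm_has_sup f).2); exists z.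
Qed.

Lemma opnorm_le (f : dual) c :
  (forall z, `|z| <= 1 -> `|f z| <= c) -> opnorm f <= c.
Proof.
move=> fc; apply: ge_sup; first exact: (opnorm_has_sup f).1.
by move=> _ [z z1 <-]; exact: fc.
Qed.

Lemma opnorm_triangle (f g : dual) : opnorm (f + g) <= opnorm f + opnorm g.
Proof.
apply: opnorm_le => z z1; rewrite dualD (le_trans (ler_normD _ _))//.
by rewrite lerD// opnorm_ub.
Qed.

Lemma opnorm_ge0 (f : dual) : 0 <= opnorm f.
Proof. by rewrite (le_trans _ (@opnorm_ub f 0 _)) ?normr0. Qed.

Lemma opnormZ_le (a : R) (f : dual) : opnorm (a *: f) <= `|a| * opnorm f.
Proof.
by apply: opnorm_le => z z1; rewrite dualZ normrM ler_wpM2l// opnorm_ub.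
Qed.

Lemma opnormZ (a : R) (f : dual) : opnorm (a *: f) = `|a| * opnorm f.
Proof.
apply/eqP; rewrite eq_le opnormZ_le/=.
have [->|a0] := eqVneq a 0; first by rewrite normr0 mul0r opnorm_ge0.
rewrite -ler_pdivlMl ?normr_gt0// -normfV.
by rewrite (le_trans _ (opnormZ_le _ _))// scalerA mulVf// scale1r.
Qed.

Lemma opnorm_eq0 (f : dual) : opnorm f = 0 -> f = 0.
Proof.
move=> f0; apply/val_inj/funext => z /=.
have [->|z0] := eqVneq z 0; first by rewrite raddf0.
have : `|f (`|z|^-1 *: z)| <= 0.
  by rewrite -f0 opnorm_ub// normrZ normfV normr_id mulVf ?normr_eq0.
rewrite linearZ/= normrZ normfV normr_id pmulr_rle0 ?invr_gt0 ?normr_gt0//.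
by rewrite normr_le0 => /eqP.
Qed.

HB.instance Definition _ :=
  Lmodule_isNormed.Build R dual opnorm_triangle opnormZ opnorm_eq0.

End dual.

Section subspace.
Context {R : realType} {X : normedModType R} (M : submodClosed X).

(** [submodClosed X] is the structure of (bundled) linear subspaces of [X];
    [subsp M] turns one into a type normed by restriction of the norm of [X],
    so that [dual (subsp M)] makes sense. When [X] is complete and [M] closed it
    is a Banach space. *)
Record subsp := Subsp { subsp_val :> X; subsp_valP : subsp_val \in M }.

HB.instance Definition _ := [isSub for subsp_val].
HB.instance Definition _ := [Choice of subsp by <:].
HB.instance Definition _ := [SubChoice_isSubLmodule of subsp by <:].

Definition subsp_norm (x : subsp) : R := `|subsp_val x|.

Lemma subsp_normD x y : subsp_norm (x + y) <= subsp_norm x + subsp_norm y.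
Proof. exact: ler_normD. Qed.

Lemma subsp_normZ (a : R) x : subsp_norm (a *: x) = `|a| * subsp_norm x.
Proof. exact: normrZ. Qed.

Lemma subsp_norm_eq0 x : subsp_norm x = 0 -> x = 0.
Proof. by move=> /normr0_eq0 x0; apply/val_inj. Qed.

HB.instance Definition _ :=
  Lmodule_isNormed.Build R subsp subsp_normD subsp_normZ subsp_norm_eq0.

End subspace.

Definition Lprojection {R : realType} {Z : normedModType R}
    (P : {linear Z -> Z}) : Prop :=
  (forall z, P (P z) = P z) /\ (forall z, `|z| = `|P z| + `|z - P z|).

Definition annihilator {R : realType} {X : normedModType R}
    (M : submodClosed X) : set (dual X) :=
  [set f | forall m, m \in M -> f m = 0].

Definition Mideal {R : realType} {X : normedModType R}
    (M : submodClosed X) : Prop :=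
  closed [set x : X | x \in M] /\
  exists P : {linear dual X -> dual X},
    Lprojection P /\ [set f | P f = 0] = annihilator M.

Definition unit_ball {R : realType} {Z : normedModType R} : set Z :=
  [set z | `|z| <= 1].

(** Valued in [\bar R], so that no convention is needed for unbounded sets. *)
Definition diameter {R : realType} {Z : normedModType R} (A : set Z) : \bar R :=
  ereal_sup [set d | exists x y, [/\ A x, A y & d = `|x - y|%:E]].

Section slices.
Context {R : realType} {Z : normedModType R}.

Definition wstar_slice (z : Z) (alpha : R) : set (dual Z) :=
  [set f : dual Z | unit_ball f /\
     f z > sup [set (u : dual Z) z | u in unit_ball] - alpha].

Definition is_wstar_slice (S : set (dual Z)) : Prop :=
  exists z alpha, 0 < alpha /\ S = wstar_slice z alpha.

Definition is_convex_combination_of_wstar_slices (C : set (dual Z)) : Prop :=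
  exists (n : nat) (lambda : 'I_n -> R) (S : 'I_n -> set (dual Z)),
    [/\ (0 < n)%N,
        forall i, is_wstar_slice (S i),
        forall i, 0 <= lambda i <= 1,
        \sum_i lambda i = 1 &
        C = [set f | exists s : 'I_n -> dual Z,
               (forall i, S i (s i)) /\ f = \sum_i lambda i *: s i] ].

End slices.

(** A property of the dual of [Z], stated in terms of the predual [Z] since
    weak* slices depend on it. *)
Definition dual_wstar_SD2P {R : realType} (Z : normedModType R) : Prop :=
  forall C : set (dual Z),
    is_convex_combination_of_wstar_slices C -> diameter C = 2%:E.

Definition nonzero_space {R : realType} (Z : normedModType R) : Prop :=
  exists z : Z, z != 0.

(* Main.v *)
From HB Require Import structures.
Require Import Defs.
From mathcomp Require Import all_boot all_order all_algebra.
From mathcomp Require Import all_classical all_reals all_analysis.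
From mathcomp Require Import ring lra.

(** Let [P] be the L-projection of the dual of [X] with kernel the annihilator
    of [M]. Restriction to [M] identifies the range of [P] isometrically with
    the dual of [M]: [P f] and [f] have the same restriction, and
    [`|P f| <= `|restriction f|] because a norm-preserving extension of the
    restriction of [f] has the same image under [P] as [f]
    ([Lprojection_norm_le]).

    Consider a weak* slice of the dual ball of [M] given by a nonzero [m] in
    [M]. The same [m], with a smaller width, gives a weak* slice of the dual
    ball of [X] whose restrictions fall in the former slice. A functional [f] in
    it almost attains the norm of [m], and does so through [P f] alone, so
    [`|P f|] is almost 1; the L-identity [`|f| = `|P f| + `|f - P f|] then
    forces [f - P f] to be small ([Lprojection_almost_fixed], [slice_lift]).
    Hence a convex combination of slices for [M] contains the restrictions of a
    convex combination of slices for [X] whose elements are all nearly fixed by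
    [P]. The latter has two elements almost at distance 2, and [P], hence the
    restriction, almost preserves that distance.

    Norm-preserving extensions, and functionals attaining the norm at a given
    vector, come from the Hahn-Banach theorem, obtained by Zorn's lemma on the
    graphs of dominated linear functionals. *)

Set Implicit Arguments.
Unset Strict Implicit.
Unset Printing Implicit Defensive.

Import Order.TTheory GRing.Theory Num.Theory.
Import numFieldNormedType.Exports.

Local Open Scope classical_set_scope.
Local Open Scope ring_scope.

(** * The Hahn-Banach theorem *)

Section hahn_banach.
Context {R : realType} {V : lmodType R} (p : V -> R).
Hypothesis p_subadditive : forall u v, p (u + v) <= p u + p v.
Hypothesis p_homogeneous : forall (t : R) v, 0 < t -> p (t *: v) = t * p v.

(** The graph of a partially defined linear functional below [p]. Functionality
    follows from the two clauses: values [r] and [s] over the same vector give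
    the values [r - s] and [s - r] over [0], and both are at most [p 0 = 0]. *)
Definition dominated_graph (G : set (V * R)) : Prop :=
  [/\ forall t x y, G x -> G y -> G (t *: x.1 + y.1, t * x.2 + y.2) &
      forall x, G x -> x.2 <= p x.1].

(** The value [c] at [x0] must lie above every [r - p (u - x0)] and below every
    [p (v + x0) - s], for [(u, r)] and [(v, s)] in [G]; subadditivity makes each
    of the former at most each of the latter, so the supremum of the former
    will do. *)
Lemma dominated_graph_extend (G : set (V * R)) (x0 : V) :
  G !=set0 -> dominated_graph G ->
  exists G', [/\ dominated_graph G', G `<=` G' & exists c, G' (x0, c)].
Proof.
move=> [w Gw] [Glin Gp].
have G0 : G (0, 0).
  by have := Glin (-1) w w Gw Gw; rewrite scaleN1r addNr mulN1r addNr.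
have GZ t x : G x -> G (t *: x.1, t * x.2).
  by move=> Gx; have := Glin t x _ Gx G0; rewrite !addr0.
pose L := [set x.2 - p (x.1 - x0) | x in G].
have Lub y : G y -> ubound L (p (y.1 + x0) - y.2).
  move=> Gy _ [x Gx <-]; rewrite lerBlDr addrAC lerBrDr.
  have := Gp _ (Glin 1 x y Gx Gy); rewrite /= scale1r mul1r => /le_trans; apply.
  have -> : x.1 + y.1 = (y.1 + x0) + (x.1 - x0) by rewrite addrACA subrr addr0 addrC.
  exact: p_subadditive.
have Lsup : has_sup L.
  split; first by exists (w.2 - p (w.1 - x0)); exists w.
  by exists (p (w.1 + x0) - w.2); exact: Lub.
pose c := sup L.
exists [set y | exists x t, G x /\ y = (x.1 + t *: x0, x.2 + t * c)]; split.
- split.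
    move=> t _ _ [x [a [Gx ->]]] [y [b [Gy ->]]] /=.
    exists (t *: x.1 + y.1, t * x.2 + y.2), (t * a + b); split; first exact: Glin.
    rewrite /= scalerDr scalerDl scalerA addrACA; congr (_, _).
    by ring.
  (* Dividing by [`|t|] reduces to [t = 1] or [t = -1], the two bounds on [c]. *)
  move=> _ [x [t [Gx ->]]] /=; case: (ltrgtP t 0) => [t0|t0|->].
  + have s0 : 0 < - t by rewrite oppr_gt0.
    have sG := GZ (- t)^-1 _ Gx.
    have : (- t)^-1 * x.2 - p ((- t)^-1 *: x.1 - x0) <= c.
      by apply: (ub_le_sup Lsup.2); exists ((- t)^-1 *: x.1, (- t)^-1 * x.2).
    rewrite -(ler_pM2l s0) mulrBr mulrA divff ?gt_eqF// mul1r -p_homogeneous//.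
    rewrite scalerBr scalerA divff ?gt_eqF// scale1r scaleNr opprK.
    by rewrite mulNr lerBlDr -lerBlDl opprK.
  + have : c <= p (t^-1 *: x.1 + x0) - t^-1 * x.2.
      by apply: ge_sup (Lsup.1) (Lub _ (GZ t^-1 _ Gx)).
    rewrite -(ler_pM2l t0) mulrBr mulrA divff ?gt_eqF// mul1r -p_homogeneous//.
    by rewrite scalerDr scalerA divff ?gt_eqF// scale1r lerBrDr addrC.
  + by rewrite scale0r mul0r !addr0; exact: Gp.
- by move=> x Gx; exists x, 0; rewrite scale0r mul0r !addr0 -surjective_pairing.
- by exists c; exists (0, 0), 1; rewrite /= scale1r mul1r !add0r.
Qed.

(** The union of the empty chain is empty and does not contain [G0], so Zorn's
    lemma is applied to the sets [A] such that [A `|` G0] is dominated. *)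
Lemma dominated_graph_maximal (G0 : set (V * R)) : dominated_graph G0 ->
  exists G, [/\ dominated_graph G, G0 `<=` G &
    forall G', dominated_graph G' -> G `<=` G' -> G' `<=` G].
Proof.
move=> G0dom.
have [|A [Adom Amax]] := @Zorn_bigcup _ [set A | dominated_graph (A `|` G0)].
  move=> F Fdom Ftot; split; last first.
    by move=> x [[A FA Ax]|]; [apply: (Fdom _ FA).2; left|exact: G0dom.2].
  move=> t x y.
  have lift A z : F A -> (A `|` G0) z -> (\bigcup_(X in F) X `|` G0) z.
    by move=> FA [Az|]; [left; exists A|right].
  move=> [[A FA Ax]|G0x] [[B FB By]|G0y].
  - have [AB|BA] := Ftot _ _ FA FB.
      by apply: (lift B) => //; apply: (Fdom _ FB).1; left => //; exact: AB.
    by apply: (lift A) => //; apply: (Fdom _ FA).1; left => //; exact: BA.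
  - by apply: (lift A) => //; apply: (Fdom _ FA).1; [left|right].
  - by apply: (lift B) => //; apply: (Fdom _ FB).1; [right|left].
  - by right; exact: G0dom.1.
exists (A `|` G0); split => // G' G'dom AG'.
have G'U : G' `|` G0 = G' by apply: setUidl => x G0x; apply: AG'; right.
apply: contrapT => G'A; apply: (Amax G'); last by rewrite /= G'U.
split; first by move=> x Ax; apply: AG'; left.
by move=> G'A'; apply: G'A => x /G'A' Ax; left.
Qed.

(** The subspace is presented by a linear map [i] rather than by a subset of
    [V], so that inclusions and maps such as [t |-> t *: z] are both covered. If
    [i] is not injective, domination already forces [f] to vanish on its
    kernel. *)
Theorem hahn_banach (U : lmodType R) (i : U -> V) (f : U -> R) :
  linear i -> (forall t u v, f (t *: u + v) = t * f u + f v) ->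
  (forall u, f u <= p (i u)) ->
  exists g : V -> R^o,
    [/\ linear g, forall v, g v <= p v & forall u, g (i u) = f u].
Proof.
move=> ilin flin fp.
have [|G [Gdom fG Gmax]] := @dominated_graph_maximal (range (fun u => (i u, f u))).
  split; last by move=> _ [u _ <-]; exact: fp.
  by move=> t _ _ [u _ <-] [v _ <-]; exists (t *: u + v); rewrite //= ilin flin.
have G_nonempty : G !=set0 by exists (i 0, f 0); apply: fG; exists 0.
have Gtotal v : exists r, G (v, r).
  have [G' [G'dom GG' [c G'c]]] := dominated_graph_extend v G_nonempty Gdom.
  by exists c; exact: Gmax G'c.
have p0 : p 0 = 0.
  by have := @p_homogeneous 2 0 (ltr0n R 2); rewrite scaler0; lra.
have Gle v r s : G (v, r) -> G (v, s) -> r <= s.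
  move=> Gr Gs; have := Gdom.2 _ (Gdom.1 (-1) _ _ Gs Gr).
  by rewrite /= scaleN1r addNr p0; lra.
have Gfun v r s : G (v, r) -> G (v, s) -> r = s.
  by move=> Gr Gs; apply/eqP; rewrite eq_le (Gle v) //= (Gle v).
have [g Gg] := choice Gtotal.
exists g; split.
- by move=> t u v; apply: Gfun (Gg _) (Gdom.1 t _ _ (Gg u) (Gg v)).
- by move=> v; exact: Gdom.2 (Gg v).
- by move=> u; apply: Gfun (Gg _) _; apply: fG; exists u.
Qed.

End hahn_banach.

(** * Norms of functionals *)

Section dual_facts.
Context {R : realType} {Z : normedModType R}.

Lemma dual_ext (f g : dual Z) : (forall z, f z = g z) -> f = g.
Proof. by move=> fg; exact/val_inj/funext. Qed.

Lemma dual_le (f : dual Z) z : `|f z| <= `|f| * `|z|.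
Proof.
have [->|z0] := eqVneq z 0; first by rewrite raddf0 !normr0 mulr0.
have : `|f (`|z|^-1 *: z)| <= `|f|.
  by apply: opnorm_ub; rewrite normrZ normfV normr_id mulVf ?normr_eq0.
by rewrite linearZ/= normrZ normfV normr_id ler_pdivrMl ?normr_gt0// mulrC.
Qed.

Lemma dual_of_bounded (g : Z -> R^o) (C : R) : 0 <= C -> linear g ->
  (forall z, `|g z| <= C * `|z|) ->
  exists f : dual Z, (forall z, f z = g z) /\ `|f| <= C.
Proof.
move=> C0 glin gC.
pose gl := GRing.isLinear.Build R Z R^o *:%R g glin.
pose G : {linear Z -> R^o} := HB.pack g gl.
have gcont : continuous g.
  apply/(@linear_bounded_continuous _ _ _ G)/bounded_funP => r.
  by exists (C * r) => z zr; rewrite (le_trans (gC z))// ler_wpM2l.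
have gP : g \in @dual_pred R Z by apply/asboolP.
exists (Dual gP); split=> //; apply: opnorm_le => z z1.
by rewrite (le_trans (gC z))// ler_piMr.
Qed.

Lemma hahn_banach_norm (U : lmodType R) (i : U -> Z) (f : U -> R) (C : R) :
  0 <= C -> linear i -> (forall t u v, f (t *: u + v) = t * f u + f v) ->
  (forall u, `|f u| <= C * `|i u|) ->
  exists h : dual Z, (forall u, h (i u) = f u) /\ `|h| <= C.
Proof.
move=> C0 ilin flin fC.
have [|||g [glin gC gf]] := @hahn_banach R Z (fun z => C * `|z|) _ _ U i f ilin flin.
- by move=> u v; rewrite -mulrDr ler_wpM2l// ler_normD.
- by move=> t v t0; rewrite normrZ gtr0_norm// mulrCA.
- by move=> u; rewrite (le_trans (ler_norm _)).
have [|h [hg hC]] := dual_of_bounded C0 glin.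
  move=> z; rewrite ler_norml gC andbT lerNl.
  have -> : - g z = g (- z).
    pose G : {linear Z -> R^o} := HB.pack g (GRing.isLinear.Build R Z R^o *:%R g glin).
    by rewrite -[g]/(G : _ -> _) raddfN.
  by rewrite -[in leRHS]normrN gC.
by exists h; split=> // u; rewrite hg gf.
Qed.

Lemma norming_functional (z : Z) : exists h : dual Z, h z = `|z| /\ `|h| <= 1.
Proof.
have [||||h [hz h1]] := @hahn_banach_norm R^o (fun t => t *: z) (fun t => t * `|z|) 1.
- exact: ler01.
- by move=> t u v; rewrite scalerDl scalerA.
- by move=> t u v; rewrite mulrDl mulrA.
- by move=> u; rewrite mul1r [leRHS]normrZ (normrM (u : R)) normr_id.
by exists h; split=> //; have := hz 1; rewrite scale1r mul1r.
Qed.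

(** This puts the threshold of a slice in terms of the norm of [z], which is the
    same in a space and in its subspaces. *)
Lemma sup_ballE (z : Z) : sup [set (u : dual Z) z | u in unit_ball] = `|z|.
Proof.
have ub : ubound [set (u : dual Z) z | u in unit_ball] `|z|.
  move=> _ [u u1 <-]; rewrite (le_trans (ler_norm _))// (le_trans (dual_le _ _))//.
  by rewrite ler_piMl.
have [h [hz h1]] := norming_functional z.
apply/eqP; rewrite eq_le ge_sup//=; last by exists (h z), h.
by apply: ub_le_sup; [exists (`|z|)|exists h].
Qed.

End dual_facts.

(** * Restriction to a subspace and L-projections *)

Section restriction.
Context {R : realType} {X : normedModType R} (M : submodClosed X).

Lemma restriction_ex (f : dual X) :
  exists g : dual (subsp M), (forall m, g m = f (subsp_val m)) /\ `|g| <= `|f|.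
Proof.
apply: (@dual_of_bounded _ _ (fun m => f (subsp_val m))) => //.
- by move=> t u v; rewrite linearP.
- by move=> z; exact: dual_le.
Qed.

Definition restriction (f : dual X) : dual (subsp M) :=
  projT1 (cid (restriction_ex f)).

Lemma restrictionE f m : restriction f m = f (subsp_val m).
Proof. by rewrite /restriction; case: cid => g []. Qed.

Lemma restriction_le f : `|restriction f| <= `|f|.
Proof. by rewrite /restriction; case: cid => g []. Qed.

Lemma restriction_linear : linear restriction.
Proof.
move=> t f g; apply: dual_ext => m.
by rewrite dualD dualZ !restrictionE.
Qed.

HB.instance Definition _ :=
  GRing.isLinear.Build R (dual X) (dual (subsp M)) *:%R restriction
    restriction_linear.

Lemma extension (g : dual (subsp M)) :
  exists h : dual X, restriction h = g /\ `|h| <= `|g|.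
Proof.
have [||||h [hg hle]] := @hahn_banach_norm R X (subsp M) (@subsp_val _ _ _) g `|g|.
- exact: normr_ge0.
- by [].
- by move=> t u v; rewrite linearP.
- by move=> u; exact: dual_le.
by exists h; split=> //; apply: dual_ext => m; rewrite restrictionE hg.
Qed.

Variable P : {linear dual X -> dual X}.
Hypothesis PL : Lprojection P.
Hypothesis kerP : [set f | P f = 0] = annihilator M.

Lemma Lprojection_restriction f : restriction (P f) = restriction f.
Proof.
have : annihilator M (P f - f) by rewrite -kerP /= linearB/= PL.1 subrr.
move=> fP; apply: dual_ext => m; rewrite !restrictionE.
by apply/eqP; rewrite -subr_eq0; apply/eqP; apply: (fP _ (subsp_valP m)).
Qed.

(** A norm-preserving extension [h] of [restriction f] differs from [f] by an
    element of the annihilator, so [P f = P h], and [P] is contractive. *)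
Lemma Lprojection_norm_le f : `|P f| <= `|restriction f|.
Proof.
have [h [hf hle]] := extension (restriction f).
have : P (h - f) = 0.
  have : annihilator M (h - f).
    move=> m mM; rewrite dualD -[(- f) m]/(- f m).
    by rewrite -(restrictionE h (Subsp mM)) hf restrictionE subrr.
  by rewrite -kerP.
move=> /eqP; rewrite linearB/= subr_eq0 => /eqP <-.
by rewrite (le_trans _ hle)// [leRHS]PL.2 lerDl.
Qed.

(** Only [P f] acts on [m], so [(1 - e) * `|m| < `|P f| * `|m|]; the L-identity
    leaves less than [e] of the norm of [f] for [f - P f]. *)
Lemma Lprojection_almost_fixed f (m : subsp M) e :
  `|f| <= 1 -> m != 0 -> `|m| - e * `|m| < restriction f m -> `|f - P f| < e.
Proof.
move=> f1 m0; rewrite -Lprojection_restriction => em.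
have mgt0 : 0 < `|m| by rewrite normr_gt0.
have : (1 - e) * `|m| < `|P f| * `|m|.
  rewrite mulrBl mul1r (lt_le_trans em)// (le_trans (ler_norm _))//.
  by rewrite restrictionE; exact: dual_le.
by rewrite ltr_pM2r//; have := PL.2 f; lra.
Qed.

End restriction.

(** * Lifting slices and the theorem *)

Lemma convex_combination_ball (R : realType) (V : normedModType R) n
    (lambda : 'I_n -> R) (s : 'I_n -> V) c :
  (forall i, 0 <= lambda i <= 1) -> \sum_i lambda i = 1 ->
  (forall i, `|s i| <= c) -> `|\sum_i lambda i *: s i| <= c.
Proof.
move=> l01 l1 sc; rewrite (le_trans (ler_norm_sum _ _ _))//.
rewrite -[leRHS]mul1r -l1 mulr_suml; apply: ler_sum => i _.
have /andP[l0 _] := l01 i.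
by rewrite normrZ ger0_norm// ler_wpM2l.
Qed.

Lemma wstar_sliceE (R : realType) (Z : normedModType R) (z : Z) a (f : dual Z) :
  wstar_slice z a f <-> `|f| <= 1 /\ `|z| - a < f z.
Proof. by rewrite /wstar_slice /= sup_ballE. Qed.

(** Slices at [z = 0] are the whole ball and give no control on [f - P f]; in
    that case any nonzero vector of [M] can be used instead of [z]. *)
Lemma slice_lift (R : realType) (X : normedModType R) (M : submodClosed X)
    (P : {linear dual X -> dual X}) (PL : Lprojection P)
    (kerP : [set f | P f = 0] = annihilator M) (M_nonzero : nonzero_space (subsp M))
    (S : set (dual (subsp M))) (e : R) :
  0 < e -> is_wstar_slice S ->
  exists T : set (dual X), is_wstar_slice T /\
    forall f, T f -> S (restriction M f) /\ `|f - P f| < e.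
Proof.
move=> e0 [z [a [a0 ->]]]; have [m1 m1_neq0] := M_nonzero.
have [m [m0 ma]] : exists m : subsp M, m != 0 /\
    forall g : dual (subsp M), `|m| - a < g m -> `|z| - a < g z.
  have [->|z0] := eqVneq z 0; last by exists z.
  by exists m1; split=> // g _; rewrite raddf0 normr0 sub0r oppr_lt0.
have mgt0 : 0 < `|m| by rewrite normr_gt0.
exists (wstar_slice (subsp_val m) (Num.min a (e * `|m|))); split.
  exists (subsp_val m), (Num.min a (e * `|m|)); split=> //.
  by rewrite lt_min a0 mulr_gt0.
move=> f /wstar_sliceE[f1]; rewrite -restrictionE -[`|subsp_val m|]/`|m| => fm.
split.
- apply/wstar_sliceE; split; first exact: le_trans (restriction_le _ _) f1.
  by apply: ma; apply: le_lt_trans fm; rewrite lerD2l lerN2 ge_min lexx.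
- apply: (Lprojection_almost_fixed PL kerP f1 m0).
  by apply: le_lt_trans fm; rewrite lerD2l lerN2 ge_min lexx orbT.
Qed.

Theorem proposition3 (R : realType) (X : completeNormedModType R)
    (M : submodClosed X)
    (X_nonzero : nonzero_space X) (M_nonzero : nonzero_space (subsp M)) :
  Mideal M -> dual_wstar_SD2P X -> dual_wstar_SD2P (subsp M).
Proof.
move=> [_ [P [PL kerP]]] XSD2P C [n [lambda [S [n0 Sslice l01 l1 ->]]]].
apply/eqP; rewrite eq_le; apply/andP; split.
  apply: ge_ereal_sup => _ [_ [_ [[s [sS ->]] [t [tS ->]] ->]]].
  have ball u : (forall i, S i (u i)) -> `|\sum_i lambda i *: u i| <= 1.
    move=> uS; apply: convex_combination_ball => // i.
    by have [z [a [_ Sza]]] := Sslice i; have := uS i; rewrite Sza => -[].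
  rewrite lee_fin (le_trans (ler_normB _ _))//.
  by rewrite -[leRHS]/(1 + 1) lerD// ball.
(* The slack [e] is spent in thirds: the distance from [f] to [g] may fall
   short of 2, and [f - P f] and [g - P g] need not vanish. *)
apply/lee_addgt0Pr => e e0.
have e3 : 0 < e / 3 by rewrite divr_gt0.
have [T /all_and2[Tslice TS]] :=
  choice (fun i => slice_lift PL kerP M_nonzero e3 (Sslice i)).
have : ((2 - e / 3)%:E < diameter [set f | exists s : 'I_n -> dual X,
    (forall i, T i (s i)) /\ f = (\sum_i lambda i *: s i)%R])%E.
  by rewrite XSD2P ?lte_fin; [lra|exists n, lambda, T].
move=> /ereal_sup_gt[_ [_ [_ [[s [sT ->]] [t [tT ->]] ->]]]].
rewrite lte_fin => st.
set f := \sum_i _ in st; set g := \sum_i _ in st.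
have near u : (forall i, T i (u i)) ->
    `|\sum_i lambda i *: u i - P (\sum_i lambda i *: u i)| <= e / 3.
  move=> uT; rewrite linear_sum -sumrB.
  under eq_bigr do rewrite linearZ/= -scalerBr.
  by apply: convex_combination_ball => // i; have [_ /ltW] := TS i _ (uT i).
apply: (@le_trans _ _ (`|restriction M f - restriction M g| + e)%:E).
  rewrite lee_fin -linearB/=.
  have := Lprojection_norm_le PL kerP (f - g); have := PL.2 (f - g).
  have : `|f - g - P (f - g)| <= e / 3 + e / 3.
    have -> : f - g - P (f - g) = (f - P f) - (g - P g).
      by rewrite linearB/= !opprB addrACA [RHS]addrACA [- g - _]addrC.
    by rewrite (le_trans (ler_normB _ _))// lerD// near.
  lra.
rewrite EFinD leeD2r//; apply: ereal_sup_ubound.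
have lift u : (forall i, T i (u i)) -> exists v : 'I_n -> dual (subsp M),
    (forall i, S i (v i)) /\
    restriction M (\sum_i lambda i *: u i) = \sum_i lambda i *: v i.
  move=> uT; exists (fun i => restriction M (u i)); split.
    by move=> i; have [] := TS i _ (uT i).
  by rewrite linear_sum; apply: eq_bigr => i _; rewrite linearZ.
by exists (restriction M f), (restriction M g); split=> //; exact: lift.
Qed.
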